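(* Let $H$ be a complex Hilbert space and let $T\in B(H)$ be a nonselfadjoint rank one operator. The following are equivalent: (i) $\mathcal S(T,T^* )$ is an SI semigroup that is not simple. (ii) $T$ is non-normal with $\operatorname{tr}T\in\mathbb R\setminus\{0,1,-1\}$ and $\|T\|=1$.
   Context: $H$ may be finite or infinite dimensional; $B(H)$ is the set of bounded linear operators on $H$. A semigroup $\mathcal S\subset B(H)$ is a subset closed under multiplication. $\mathcal S(T,T^* )$ is the semigroup generated by $\{T,T^*\}$, i.e. the set of all finite nonempty words in $T$ and $T^*$. An ideal $J$ of a semigroup $\mathcal S$ is a (two-sided) multiplicative ideal: a subset $J\subset\mathcal S$ with $XA, AX\in J$ for all $A\in J$, $X\in\mathcal S$ (no closure under sums or scalars is required). $\mathcal S$ is a selfadjoint-ideal (SI) semigroup if every ideal $J$ of $\mathcal S$ satisfies $\{A^*: A\in J\}\subset J$. $\mathcal S$ is simple if its only nonzero ideal (i.e. ideal containing a nonzero operator) is $\mathcal S$ itself; $\mathcal S$ may or may not contain $0$. $\operatorname{tr}$ denotes the trace and $\|\cdot\|$ the operator norm. *)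

(* Defs.v *)
From HB Require Import structures.
From mathcomp Require Import all_boot all_order all_algebra complex.
From mathcomp Require Import sesquilinear.
From mathcomp Require Import all_classical all_reals all_analysis.
Set Implicit Arguments.
Unset Strict Implicit.
Unset Printing Implicit Defensive.
Import Order.TTheory GRing.Theory Num.Theory.
Import numFieldNormedType.Exports.
Local Open Scope classical_set_scope.
Local Open Scope ring_scope.
Local Open Scope complex_scope.

(* [inner] is linear in its first and conjugate-linear in its second argument. *)
Record hilbert (R : realType) := Hilbert {
  hilbert_space :> completeNormedModType R[i] ;
  inner : {dot hilbert_space for Num.conj} ;
  inner_norm : forall x : hilbert_space, inner x x = `|x| ^+ 2
}.

Arguments inner {R h}.

Section Hilbert.
Variables (R : realType) (H : hilbert R).
Implicit Types (T A B : H -> H) (E F : set H) (S J G : set (H -> H)).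

(* Operators are plain functions, so that products are compositions and
   equality of operators is equality of functions. *)
Definition bounded_operator : set (H -> H) :=
  [set T | linear T /\ exists M : R[i], forall x, `|T x| <= M * `|x|].

Definition is_adjoint T B :=
  bounded_operator B /\ forall x y, inner (T x) y = inner x (B y).

(* For bounded [T] the adjoint exists (Riesz) and is unique; otherwise junk. *)
Definition adjoint T : H -> H := xget (fun=> 0) [set B | is_adjoint T B].

Definition selfadjoint T := adjoint T = T.

Definition normal_operator T := T \o adjoint T = adjoint T \o T.

Definition rank_one T :=
  exists2 u : H, u != 0 & range T = [set c *: u | c in [set: R[i]]].

Definition opnorm T : R :=
  sup [set complex.Re `|T x| | x in [set x : H | `|x| <= 1]].

Definition orthonormal_set E :=
  forall e f, E e -> E f -> inner e f = (e == f)%:R.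

Definition orthonormal_basis E :=
  orthonormal_set E /\ forall F, orthonormal_set F -> E `<=` F -> F = E.

(* [t] is the unordered sum of [f] over [E]: the limit of the net of its
   sums over the finite subsets of [E], directed by inclusion. *)
Definition has_sum E (f : H -> R[i]) (t : R[i]) :=
  forall eps : R, 0 < eps -> exists2 F0 : set H,
    finite_set F0 /\ F0 `<=` E &
    forall F, finite_set F -> F0 `<=` F -> F `<=` E ->
      `|\sum_(e \in F) f e - t| < eps%:C.

Definition is_trace T t :=
  forall E, orthonormal_basis E -> has_sum E (fun e => inner (T e) e) t.

(* Junk unless the basis sums of [T] all converge to the same value, which is
   the case for trace class, hence for finite rank, operators. *)
Definition trace T : R[i] := xget 0 [set t | is_trace T t].

Inductive generated_semigroup G : set (H -> H) :=
| generated_letter A : G A -> generated_semigroup G A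
| generated_word A B :
    G A -> generated_semigroup G B -> generated_semigroup G (A \o B).

Definition semigroup_with_adjoint T : set (H -> H) :=
  generated_semigroup [set T; adjoint T].

Definition semigroup_ideal S J :=
  J `<=` S /\ forall A X, J A -> S X -> J (X \o A) /\ J (A \o X).

Definition SI_semigroup S :=
  forall J, semigroup_ideal S J -> adjoint @` J `<=` J.

Definition nonzero_set J := exists2 A, J A & A <> (fun=> 0).

Definition simple_semigroup S :=
  forall J, semigroup_ideal S J -> nonzero_set J -> J = S.

End Hilbert.

(* Main.v *)
Require Import Defs.
From mathcomp Require Import all_boot all_order all_algebra complex sesquilinear.
From mathcomp Require Import all_classical all_reals all_analysis.
From mathcomp Require Import finmap zify ring lra.
Set Implicit Arguments.
Unset Strict Implicit.
Unset Printing Implicit Defensive.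
Import Order.TTheory GRing.Theory Num.Theory.
Import numFieldNormedType.Exports.
Local Open Scope classical_set_scope.
Local Open Scope ring_scope.
Local Open Scope complex_scope.

(** By the Riesz theorem [T x = <x, v> u]; its adjoint is [x |-> <x, u> v], its
    trace is [a = <u, v>] (Parseval), and [|T|^2 = s] with [s = |u|^2 |v|^2].
    Every word in [T] and [T*] is [a^i conj(a)^j s^k] times one of [T], [T*],
    [T T*], [T* T].

    Let the semigroup be SI. The ideal generated by [T] contains [T*], so [T*] is
    a word containing [T]. If [u] and [v] are independent (that is, [T] is not
    normal), this forces [a^i conj(a)^j s^k = 1] with [k > 0]. If [i + j > 0],
    then [a], [conj a] and [s] are invertible in the monoid they generate and
    every nonzero ideal contains [T], so the semigroup is simple; it is also
    simple if [a = 0] and [s = 1]. Otherwise [s = 1] and [0 < |a| < 1], and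
    [T*^2 = conj(a) T*] lies in the ideal generated by [T^2 = a T], which
    forces [conj a = a]. If [u] and [v] are dependent, then [|a|^2 = s] and
    comparing norms in [T* = word] gives [s = 1], so the semigroup is simple.

    Conversely, if [s = 1] and [a] is real, then [T* (c T) T* = c T*] for every
    [c], and the words of norm at most [|a|] form a proper nonzero ideal. *)

(** * Inner product geometry: minimal vectors, Cauchy-Schwarz, Riesz *)

Section Inner.
Variables (R : realType) (H : hilbert R).
Implicit Types (x y z : H) (c : R[i]).

Lemma innerC x y : inner x y = (inner y x)^*%R.
Proof. by rewrite hermC expr0 mul1r. Qed.

Lemma innerZl c x y : inner (c *: x) y = c * inner x y.
Proof. by rewrite linearZl_LR. Qed.

Lemma innerZr c x y : inner x (c *: y) = c^*%R * inner x y.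
Proof. by rewrite linearZr_LR. Qed.

Lemma innerDl x y z : inner (x + y) z = inner x z + inner y z.
Proof. by rewrite linearDl. Qed.

Lemma innerDr x y z : inner x (y + z) = inner x y + inner x z.
Proof. by rewrite linearDr. Qed.

Lemma innerBl x y z : inner (x - y) z = inner x z - inner y z.
Proof. by rewrite linearBl. Qed.

Lemma innerBr x y z : inner x (y - z) = inner x y - inner x z.
Proof. by rewrite linearBr. Qed.

Lemma innerNl x y : inner (- x) y = - inner x y.
Proof. by rewrite linearNl. Qed.

Lemma innerNr x y : inner x (- y) = - inner x y.
Proof. by rewrite linearNr. Qed.

Lemma inner0l x : inner 0 x = 0.
Proof. by rewrite linear0l. Qed.

Lemma inner0r x : inner x 0 = 0.
Proof. by rewrite linear0r. Qed.

(* The norm of [H] is [R[i]]-valued; [rnorm] is the same norm with values in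
   the totally ordered field [R]. *)
Definition rnorm (x : H) : R := complex.Re `|x|.

Lemma rnormE x : `|x| = (rnorm x)%:C.
Proof. by rewrite /rnorm RRe_real // normr_real. Qed.

Lemma rnorm_ge0 x : 0 <= rnorm x.
Proof. by rewrite -ler0c -rnormE. Qed.

Lemma rnormD x y : rnorm (x + y) <= rnorm x + rnorm y.
Proof. by rewrite -lecR rmorphD /= -!rnormE ler_normD. Qed.

Lemma rnormN x : rnorm (- x) = rnorm x.
Proof. by rewrite /rnorm normrN. Qed.

Lemma rnormB x y : rnorm (x - y) = rnorm (y - x).
Proof. by rewrite -rnormN opprB. Qed.

Lemma rnorm_eq0 x : rnorm x = 0 -> x = 0.
Proof. by move=> x0; apply/normr0_eq0; rewrite rnormE x0. Qed.

Lemma innerxx x : inner x x = (rnorm x ^+ 2)%:C.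
Proof. by rewrite inner_norm rnormE rmorphXn. Qed.

Lemma parallelogram x y :
  rnorm (x + y) ^+ 2 + rnorm (x - y) ^+ 2 =
  rnorm x ^+ 2 *+ 2 + rnorm y ^+ 2 *+ 2.
Proof.
apply: complexI; rewrite !(rmorphD, rmorphMn) /= -!innerxx.
rewrite !(innerDl, innerDr, innerNl, innerNr); ring.
Qed.

Lemma gt0_complex c : 0 < c -> exists2 r : R, 0 < r & c = r%:C.
Proof.
move=> c0; exists (complex.Re c); last by rewrite RRe_real // gtr0_real.
by rewrite -ltcR RRe_real // gtr0_real.
Qed.

Lemma rnorm_half x : rnorm x ^+ 2 = 4 * rnorm (2^-1 *: x) ^+ 2.
Proof.
apply: complexI; rewrite [RHS]rmorphM /= -!innerxx innerZl innerZr.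
by rewrite rmorphV /= ?unitfE ?pnatr_eq0 // !rmorph_nat; field.
Qed.

(* By the parallelogram identity, minimising sequences are Cauchy. *)
Lemma min_norm_closure (K : set H) : K !=set0 ->
  (forall x y, K x -> K y -> K (2^-1 *: (x + y))) ->
  exists y, (forall k, K k -> rnorm y <= rnorm k) /\
    (forall e : R, 0 < e -> exists2 k, K k & rnorm (y - k) < e).
Proof.
move=> K0 Kmid; pose D := [set rnorm k ^+ 2 | k in K].
have D0 : has_inf D.
  split; first by case: K0 => k Kk; exists (rnorm k ^+ 2), k.
  by exists 0 => _ [k _ <-]; rewrite sqr_ge0.
have infD k : K k -> inf D <= rnorm k ^+ 2.
  by move=> Kk; apply: ge_inf; [exact: D0.2 | exists k].
have /choice[k_ kP] (n : nat) : exists k, K k /\ rnorm k ^+ 2 < inf D + n.+1%:R^-1.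
  have n0 : (0 : R) < n.+1%:R^-1 by rewrite invr_gt0.
  by have [_ [k Kk <-] lt] := inf_adherent n0 D0; exists k.
have dist n m : rnorm (k_ n - k_ m) ^+ 2 < 2 * n.+1%:R^-1 + 2 * m.+1%:R^-1.
  have [Kn hn] := kP n; have [Km hm] := kP m.
  have := infD _ (Kmid _ _ Kn Km).
  have := parallelogram (k_ n) (k_ m); rewrite (rnorm_half (_ + _)).
  move: hn hm; move: (n.+1%:R^-1) (m.+1%:R^-1) (inf D) => i j d.
  lra.
have small (e : R) : 0 < e -> exists N, forall n, (N <= n)%N -> n.+1%:R^-1 < e.
  move=> e0; have := near_infty_natSinv_lt (PosNum e0).
  by case=> N _ hN; exists N => n Nn; apply: hN.
have cvgk : cvg (k_ @ \oo).
  apply: cauchy_cvg; apply: cauchy_exP => e /gt0_complex[r r0 ->].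
  have /small[N hN] : 0 < r ^+ 2 / 4 by rewrite divr_gt0 ?exprn_gt0.
  exists (k_ N); exists N => // n Nn.
  rewrite /= -ball_normE /= rnormE ltcR.
  rewrite -(@ltr_pXn2r _ 2) ?nnegrE ?rnorm_ge0 ?ltW //.
  have := dist N n; have := hN _ Nn; have := hN _ (leqnn N).
  by move: (N.+1%:R^-1) (n.+1%:R^-1) => i j; lra.
pose y := lim (k_ @ \oo).
have near_y (e : R) : 0 < e -> exists N, forall n, (N <= n)%N -> rnorm (y - k_ n) < e.
  move=> e0; have /cvgrPdist_lt/(_ e%:C) := cvgk.
  rewrite ltcR => /(_ e0)[N _ hN]; exists N => n Nn.
  by rewrite -ltcR -rnormE; apply: hN.
exists y; split=> [k Kk|e e0]; last first.
  by have [N hN] := near_y _ e0; exists (k_ N); [exact: (kP N).1 | exact: hN].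
rewrite leNgt; apply/negP => lt_ky.
(* With this gap [e], a late term [k_ n] within [e / 2] of [y] has norm above [rnorm k + e / 2], so
   its square exceeds [inf D + e ^+ 2 / 4], against the choice of [k_]. *)
pose e := rnorm y - rnorm k.
have e0 : 0 < e by rewrite subr_gt0.
have [N hN] : exists N, forall n, (N <= n)%N -> rnorm (y - k_ n) < e / 2.
  by apply: near_y; rewrite divr_gt0.
have [M hM] : exists M, forall n, (M <= n)%N -> n.+1%:R^-1 < e ^+ 2 / 4.
  by apply: small; rewrite divr_gt0 ?exprn_gt0.
have h1 := hN _ (leq_maxl N M); have h2 := hM _ (leq_maxr N M).
have [_ h3] := kP (maxn N M).
have := rnormD (y - k_ (maxn N M)) (k_ (maxn N M)); rewrite subrK => h4.
have h5 := infD _ Kk; have h6 := rnorm_ge0 k.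
have : rnorm k + e / 2 < rnorm (k_ (maxn N M)).
  by rewrite {1}/e in h1; rewrite /e; lra.
move: h2 h3; set c := rnorm (k_ _); set i := (_.+1%:R^-1) => h2 h3 h7.
have : (rnorm k + e / 2) ^+ 2 < c ^+ 2.
  by rewrite ltr_pXn2r ?nnegrE ?rnorm_ge0 ?addr_ge0 ?divr_ge0 // ltW.
nra.
Qed.

(** The vector is [q] times the component of [x] orthogonal to [y], and the last factor is a Gram
    determinant: its sign gives Cauchy-Schwarz, its vanishing the equality case. *)
Lemma inner_gap x y : let a := inner x y in let q := inner y y in
  inner (q *: x - a *: y) (q *: x - a *: y) = q * (inner x x * q - a * a^*%R).
Proof.
move=> a q; rewrite !(innerBl, innerBr, innerZl, innerZr) -!/a (innerC y x) -!/a.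
rewrite -!/q; have -> : q^*%R = q by rewrite /q -innerC.
ring.
Qed.

Lemma inner_ge0 x : 0 <= inner x x.
Proof. by rewrite innerxx ler0c sqr_ge0. Qed.

Lemma inner_eq0 x : inner x x = 0 -> x = 0.
Proof.
rewrite innerxx => /(congr1 (@complex.Re R))/= /eqP; rewrite sqrf_eq0 => /eqP.
exact: rnorm_eq0.
Qed.

Lemma inner_gt0 x : x != 0 -> 0 < inner x x.
Proof.
move=> x0; rewrite lt_def inner_ge0 andbT.
by apply: contra x0 => /eqP/inner_eq0 ->.
Qed.

Lemma Cauchy_Schwarz x y : inner x y * (inner x y)^*%R <= inner x x * inner y y.
Proof.
have [->|y0] := eqVneq y 0; first by rewrite !inner0r mul0r mulr0.
have := inner_ge0 (inner y y *: x - inner x y *: y).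
by rewrite inner_gap pmulr_rge0 ?inner_gt0 // subr_ge0.
Qed.

Lemma Cauchy_Schwarz_eq x y :
  inner x y * (inner x y)^*%R = inner x x * inner y y ->
  inner y y *: x = inner x y *: y.
Proof.
move=> xy; apply/subr0_eq/inner_eq0.
by rewrite inner_gap -xy subrr mulr0.
Qed.

Lemma norm_inner_le x y : `|inner x y| <= (rnorm x * rnorm y)%:C.
Proof.
have xy0 : 0 <= (rnorm x * rnorm y)%:C by rewrite ler0c mulr_ge0 ?rnorm_ge0.
rewrite -(@ler_pXn2r _ 2) ?nnegrE ?normr_ge0 //.
by rewrite normCK -rmorphXn exprMn [leRHS]rmorphM /= -!innerxx Cauchy_Schwarz.
Qed.

(** Subtracting the multiple of [y] with coefficient [inner x y / inner y y] lowers the squared norm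
    of [x] by |<x, y>|^2 / <y, y>, which minimality forces to be zero. *)
Lemma min_norm_ortho x y :
  (forall c, rnorm x <= rnorm (x - c *: y)) -> inner x y = 0.
Proof.
have [->|y0] := eqVneq y 0; first by rewrite inner0r.
move=> /(_ (inner x y / inner y y)) xmin.
have q0 := inner_gt0 y0; have qN0 : inner y y != 0 by rewrite gt_eqF.
have : rnorm x ^+ 2 <= rnorm (x - (inner x y / inner y y) *: y) ^+ 2.
  by rewrite ler_pXn2r ?nnegrE ?rnorm_ge0.
rewrite -lecR -!innerxx.
have -> : x - (inner x y / inner y y) *: y =
    (inner y y)^-1 *: (inner y y *: x - inner x y *: y).
  by rewrite scalerBr !scalerA mulVf // scale1r mulrC.
rewrite innerZl innerZr inner_gap rmorphV ?unitfE //= -innerC.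
have alg (p q d : R[i]) : q != 0 ->
    q^-1 * (q^-1 * (q * (p * q - d))) = p - d / q.
  by move=> hq; field.
rewrite alg // -subr_ge0 addrAC subrr sub0r oppr_ge0 => h.
apply/eqP; rewrite -normr_eq0 -sqrf_eq0 normCK eq_le.
have /pmulr_lle0 <- : 0 < (inner y y)^-1 by rewrite invr_gt0.
by rewrite h -normCK exprn_ge0.
Qed.

Lemma rnorm_le_ortho x y : inner x y = 0 -> rnorm x <= rnorm (x + y).
Proof.
move=> xy; rewrite -(@ler_pXn2r _ 2) ?nnegrE ?rnorm_ge0 // -lecR -!innerxx.
rewrite !(innerDl, innerDr) (innerC y x) xy rmorph0 addr0 add0r.
by rewrite lerDl inner_ge0.
Qed.

(** A vector [y] of least norm with [f y = 1] is orthogonal to the kernel of [f], and a multiple of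
    it represents [f]. *)
Lemma riesz (f : H -> R[i]) : scalar f ->
  (exists M, forall x, `|f x| <= M * `|x|) -> exists v, forall x, f x = inner x v.
Proof.
move=> flin [M fM].
have f0 : f 0 = 0.
  by have := flin (-1) 0 0; rewrite scaler0 addr0 mulN1r addNr.
have fZ c x : f (c *: x) = c * f x.
  by rewrite -[c *: x]addr0 flin f0 addr0.
have fD x y : f (x + y) = f x + f y by rewrite -[x]scale1r flin mul1r scale1r.
have fB x y : f (x - y) = f x - f y by rewrite fD -scaleN1r fZ mulN1r.
have [fx0|] := pselect (forall x, f x = 0).
  by exists 0 => x; rewrite fx0 inner0r.
move=> /existsNP[x0 /eqP fx0].
have [||y [ymin yK]] := @min_norm_closure [set x | f x = 1].
- by exists ((f x0)^-1 *: x0); rewrite /= fZ mulVf.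
- by move=> x y /= fx fy; rewrite fZ fD fx fy mulVf // pnatr_eq0.
pose r := complex.Re `|M|.
have rE : `|M| = r%:C by rewrite /r RRe_real // normr_real.
have r0 : 0 <= r by rewrite -ler0c -rE.
have fr x : `|f x| <= (r * rnorm x)%:C.
  rewrite rmorphM /= -rE -rnormE -(normr_id x) -normrM.
  by apply: le_trans (fM x) _; apply: real_ler_norm; apply: ger0_real; apply: le_trans (fM x).
(* [y] is only known as a limit of points where [f] is 1, so its value comes from the boundedness of
   [f]. *)
have fy : f y = 1.
  apply/subr0_eq/normr0_eq0.
  have -> : `|f y - 1| = (complex.Re `|f y - 1|)%:C by rewrite RRe_real // normr_real.
  congr (_%:C); apply/eqP; rewrite eq_le; apply/andP; split; last first.
    by rewrite -lecR RRe_real ?normr_real ?normr_ge0.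
  apply/ler_addgt0Pl => e e0; rewrite ?(add0r, addr0).
  have [|k fk yk] := yK (e / (r + 1)); first by rewrite divr_gt0 // ltr_wpDl.
  have := fr (y - k); rewrite fB fk -[X in X <= _]RRe_real ?normr_real // lecR.
  move=> /le_trans; apply.
  rewrite ltr_pdivlMr ?ltr_wpDl // in yk.
  by apply: le_trans (ltW yk); rewrite mulrDr mulr1 mulrC lerDl rnorm_ge0.
have y0 : y != 0 by apply: contra_eq_neq fy => ->; rewrite f0 eq_sym oner_eq0.
have yker z : f z = 0 -> inner y z = 0.
  move=> fz; apply: min_norm_ortho => c; apply: ymin => /=.
  by rewrite fB fZ fz mulr0 subr0.
exists ((inner y y)^-1 *: y) => x.
(* Orthogonality of [y] to this kernel vector reads <x, y> = f(x) <y, y>. *)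
have /yker : f (x - f x *: y) = 0 by rewrite fB fZ fy mulr1 subrr.
rewrite innerC => /eqP; rewrite fmorph_eq0 innerBl innerZl subr_eq0 => /eqP xy.
have q0 : inner y y != 0 by rewrite gt_eqF // inner_gt0.
by rewrite innerZr xy rmorphV ?unitfE //= -innerC mulrC mulfK.
Qed.

(** * Orthonormal bases, finite projections and unordered sums *)

Implicit Types E F : set H.

Definition ortho_proj F x : H := \sum_(e \in F) inner x e *: e.

Lemma inner_ortho_proj F x y : finite_set F ->
  inner (ortho_proj F x) y = \sum_(e \in F) inner x e * inner e y.
Proof.
move=> finF; rewrite /ortho_proj !fsbig_finite //.
rewrite (big_morph (inner^~ y) (fun u v => innerDl u v y) (inner0l y)).
by apply: eq_bigr => e _; rewrite innerZl.
Qed.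

Lemma ortho_proj_linear F c x y : finite_set F ->
  ortho_proj F (c *: x + y) = c *: ortho_proj F x + ortho_proj F y.
Proof.
move=> finF; rewrite /ortho_proj !fsbig_finite // scaler_sumr -big_split.
by apply: eq_bigr => e _; rewrite innerDl innerZl scalerDl scalerA.
Qed.

Lemma ortho_proj_id E F e : orthonormal_set E -> finite_set F -> F `<=` E ->
  F e -> ortho_proj F e = e.
Proof.
move=> onE finF FE Fe; rewrite /ortho_proj fsbig_finite //.
have eF : e \in fset_set F by rewrite in_fset_set ?mem_set.
rewrite (bigD1_seq e) ?fset_uniq //= big1_seq ?addr0.
  by rewrite onE ?eqxx ?scale1r //; exact: FE.
move=> f /andP[fe]; rewrite in_fset_set // => /set_mem Ff.
by rewrite onE ?(eq_sym e) ?(negPf fe) ?scale0r //; exact: FE.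
Qed.

Lemma ortho_projP E F x e : orthonormal_set E -> finite_set F -> F `<=` E ->
  F e -> inner (x - ortho_proj F x) e = 0.
Proof.
move=> onE finF FE Fe; rewrite innerBl inner_ortho_proj // fsbig_finite //.
have eF : e \in fset_set F by rewrite in_fset_set ?mem_set.
rewrite (bigD1_seq e) ?fset_uniq //= big1_seq ?addr0.
  by rewrite (onE e e) ?eqxx ?mulr1 ?subrr //; exact: FE.
move=> f /andP[fe]; rewrite in_fset_set // => /set_mem Ff.
by rewrite (onE f e) ?(negPf fe) ?mulr0 //; exact: FE.
Qed.

(** With P the projection, x - P y is the sum of x - P x and P (x - y), which are orthogonal. *)
Lemma ortho_proj_best E F x y : orthonormal_set E -> finite_set F -> F `<=` E ->
  rnorm (x - ortho_proj F x) <= rnorm (x - ortho_proj F y).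
Proof.
move=> onE finF FE.
have -> : x - ortho_proj F y = x - ortho_proj F x + ortho_proj F (x - y).
  have -> : x - y = -1 *: y + x by rewrite scaleN1r addrC.
  by rewrite ortho_proj_linear // scaleN1r addrA addrAC subrK.
apply: rnorm_le_ortho; rewrite innerC inner_ortho_proj //.
rewrite fsbig1 ?rmorph0 // => e Fe.
by rewrite (innerC e) (ortho_projP _ onE) // rmorph0 mulr0.
Qed.

(** Otherwise the normalised [x] could be added to [E], against maximality. *)
Lemma orthonormal_basis_total E x : orthonormal_basis E ->
  (forall e, E e -> inner x e = 0) -> x = 0.
Proof.
move=> [onE Emax] xE; apply: contrapT => /eqP x0.
pose c := ((rnorm x)^-1)%:C.
have cE : c^*%R = c by rewrite conj_Creal // complex_real.
have rx : rnorm x != 0 by apply: contra x0 => /eqP/rnorm_eq0 ->.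
have cx : inner (c *: x) (c *: x) = 1.
  rewrite innerZl innerZr cE innerxx -!rmorphM /= mulrA -expr2 exprVn mulVf //.
  by rewrite expf_neq0.
have cxE e : E e -> inner (c *: x) e = 0 by move=> Ee; rewrite innerZl xE // mulr0.
have cxNE : ~ E (c *: x).
  by move=> /cxE; rewrite cx => /eqP; rewrite oner_eq0.
have : E `|` [set c *: x] = E.
  apply: Emax => [e f [Ee|->] [Ef|->]|]; [exact: onE|..|by left].
  - rewrite innerC cxE // rmorph0; case: eqP => // ee; by rewrite ee in Ee.
  - rewrite cxE //; case: eqP => // ee; by rewrite -ee in Ef.
  - by rewrite cx eqxx.
by move=> EE; apply: cxNE; rewrite -EE; right.
Qed.

(* The defect vectors [x - z], with [z] in the span of [E], have a limit of
   minimal norm; it is orthogonal to [E], hence zero. *)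
Lemma ortho_proj_cvg E x (eps : R) : orthonormal_basis E -> 0 < eps ->
  exists2 F0 : set H, finite_set F0 /\ F0 `<=` E &
    forall F, finite_set F -> F0 `<=` F -> F `<=` E ->
      rnorm (x - ortho_proj F x) < eps.
Proof.
move=> bE eps0; have onE := bE.1.
(* The linear span of [E], encoded by the property used at the end: its vectors are fixed by the
   projections for all large finite subsets of [E]. *)
pose span z := exists2 F, finite_set F /\ F `<=` E &
  forall F', finite_set F' -> F `<=` F' -> F' `<=` E -> ortho_proj F' z = z.
have span0 : span 0.
  exists set0; first by split; [exact: finite_set0 | exact: sub0set].
  move=> F' _ _ _.
  by rewrite /ortho_proj fsbig1 // => e _; rewrite inner0l scale0r.
have spanE e : E e -> span e.
  move=> Ee; exists [set e]; first by split=> [|_ ->//]; exact: finite_set1.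
  by move=> F' finF' eF' F'E; apply: (ortho_proj_id onE) => //; exact: eF'.
have spanL c y z : span y -> span z -> span (c *: y + z).
  move=> [F1 [fin1 sub1] h1] [F2 [fin2 sub2] h2]; exists (F1 `|` F2).
    by split; [rewrite finite_setU | rewrite subUset].
  move=> F finF; rewrite subUset => -[F1F F2F] FE.
  by rewrite ortho_proj_linear // h1 // h2.
have spanZ c z : span z -> span (c *: z).
  by move=> sz; rewrite -[_ *: _]addr0; exact: spanL.
have [||y [ymin yK]] := @min_norm_closure [set x - z | z in span].
- by exists (x - 0); exists 0.
- move=> _ _ [z1 s1 <-] [z2 s2 <-]; exists (2^-1 *: (1 *: z1 + z2)).
    exact/spanZ/spanL.
  rewrite scale1r addrACA -opprD scalerBr; congr (_ - _).
  have h2 : 2^-1 + 2^-1 = 1 :> R[i] by field.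
  by rewrite scalerDr -scalerDl h2 scale1r.
have y0 : y = 0.
  apply: (orthonormal_basis_total bE) => e Ee; apply: min_norm_ortho => c.
  (* [y] need not have the form [x - z], so it is replaced by such a vector at distance less than
     [d]. *)
  apply/ler_addgt0Pl => d d0.
  have [_ [z sz <-] yz] := yK _ d0.
  have /ymin/le_trans : [set x - z | z in span] (x - z - c *: e).
    exists (c *: e + z); first exact/spanL/sz/spanE.
    by rewrite opprD addrA addrAC.
  apply; have -> : x - z - c *: e = (x - z - y) + (y - c *: e).
    by rewrite addrA subrK.
  by rewrite (le_trans (rnormD _ _)) // lerD2r rnormB ltW.
have [_ [z [F0 F0P hF0] <-]] := yK _ eps0.
rewrite y0 sub0r rnormN => xz.
exists F0 => // F finF F0F FE; apply: le_lt_trans xz.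
by rewrite -[in leRHS](hF0 F) //; apply: (ortho_proj_best _ _ onE).
Qed.

Lemma ex_orthonormal_basis : exists E : set H, orthonormal_basis E.
Proof.
have [S SP Stot|A [onA Amax]] := @Zorn_bigcup H (@orthonormal_set R H).
  move=> e f [X SX Xe] [Y SY Yf].
  have [XY|YX] := Stot _ _ SX SY; [exact: SP (XY _ Xe) Yf|exact: SP Xe (YX _ Yf)].
exists A; split=> // F onF AF; apply: contrapT => FA.
by apply: (Amax F) => //; split=> // FA'; apply: FA; apply/seteqP.
Qed.

Lemma has_sum_unique E f (s t : R[i]) : has_sum E f s -> has_sum E f t -> s = t.
Proof.
move=> hs ht; apply/subr0_eq/normr0_eq0.
have rE : `|s - t| = (complex.Re `|s - t|)%:C by rewrite RRe_real ?normr_real.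
rewrite rE; congr (_%:C); apply/eqP; rewrite eq_le; apply/andP; split; last first.
  by rewrite -lecR -rE normr_ge0.
apply/ler_addgt0Pl => e e0; rewrite ?(add0r, addr0).
have e20 : 0 < e / 2 by rewrite divr_gt0.
have [F1 [fin1 sub1] h1] := hs _ e20; have [F2 [fin2 sub2] h2] := ht _ e20.
have finU : finite_set (F1 `|` F2) by rewrite finite_setU.
have subU : F1 `|` F2 `<=` E by rewrite subUset.
have {}h1 := h1 _ finU (@subsetUl _ _ _) subU.
have {}h2 := h2 _ finU (@subsetUr _ _ _) subU.
rewrite -lecR -rE; set S := \sum_(_ \in _) _ in h1 h2.
have -> : s - t = (S - t) - (S - s) by ring.
rewrite (le_trans (ler_normB _ _)) // [e]splitr rmorphD /=.
by rewrite lerD // ltW.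
Qed.
End Inner.

(** * Rank one operators: products, adjoint, trace and norm *)

Section RankOne.
Variables (R : realType) (H : hilbert R).
Implicit Types (x y z u v : H) (c d : R[i]) (A B T X : H -> H).

(** The scalar is kept apart from the vectors because all words are built on the same [u] and
    [v]. *)
Definition rank1 c u v : H -> H := fun x => (c * inner x v) *: u.

Lemma rank1_comp c d x y u v :
  rank1 c x y \o rank1 d u v = rank1 (c * d * inner u y) x v.
Proof. by apply/funext => z; rewrite /rank1 /= innerZl; congr (_ *: _); ring. Qed.

Lemma rank1_inj c d x y : x != 0 -> y != 0 -> rank1 c x y = rank1 d x y -> c = d.
Proof.
move=> x0 y0 /(congr1 (@^~ y))/eqP; rewrite /rank1 -subr_eq0 -scalerBl.
rewrite scaler_eq0 (negPf x0) orbF -mulrBl mulf_eq0 subr_eq0.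
by rewrite (gt_eqF (inner_gt0 y0)) orbF => /eqP.
Qed.

Lemma rank1_sqnorm c x y z :
  inner (rank1 c x y z) (rank1 c x y z) =
  c * c^*%R * inner x x * (inner z y * (inner z y)^*%R).
Proof. by rewrite /rank1 innerZl innerZr rmorphM /=; ring. Qed.

Lemma rank1_bounded c u v : bounded_operator (rank1 c u v).
Proof.
split=> [k x y|]; first by rewrite /rank1 innerDl innerZl scalerA -scalerDl;
  congr (_ *: _); ring.
exists (`|c| * (rnorm v * rnorm u)%:C) => x.
rewrite /rank1 normrZ normrM -!mulrA ler_wpM2l // !rnormE.
apply: le_trans (ler_wpM2r _ (norm_inner_le _ _)) _.
  by rewrite ler0c rnorm_ge0.
by rewrite !rmorphM /= [leRHS]mulrC mulrA.
Qed.

Lemma adjoint_unique T B : is_adjoint T B -> adjoint T = B.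
Proof.
move=> adjB; rewrite /adjoint; apply: xget_unique => //= B' adjB'.
apply/funext => y; apply/subr0_eq/inner_eq0.
by rewrite innerBr -adjB.2 -adjB'.2 subrr.
Qed.

Lemma adjoint_rank1 c u v : adjoint (rank1 c u v) = rank1 c^*%R v u.
Proof.
apply: adjoint_unique; split; first exact: rank1_bounded.
move=> x y; rewrite /rank1 innerZl innerZr rmorphM /= conjCK -innerC.
by ring.
Qed.

(** The coefficient of [T x] along a spanning vector [u] of the range is a bounded linear functional
    of [x], to which Riesz applies. *)
Lemma rank_one_rank1 T : bounded_operator T -> rank_one T ->
  exists u v, [/\ u != 0, v != 0 & T = rank1 1 u v].
Proof.
move=> [Tlin [M TM]] [u u0 Tu].
have /choice[f fP] x : exists c, T x = c *: u.
  have : range T (T x) by exists x.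
  by rewrite Tu => -[c _ <-]; exists c.
have uinj : injective (fun c => c *: u).
  move=> c d /= /eqP; rewrite -subr_eq0 -scalerBl scaler_eq0 (negPf u0) orbF.
  by rewrite subr_eq0 => /eqP.
have [||v fv] := @riesz R H f.
- move=> c x y; apply: uinj; rewrite -fP Tlin !fP /=.
  by rewrite scalerDl scalerA.
- exists (M / `|u|) => x; rewrite mulrAC ler_pdivlMr ?normr_gt0 //.
  by rewrite -normrZ -fP.
have TE : T = rank1 1 u v.
  by apply/funext => x; rewrite fP fv /rank1 mul1r.
exists u, v; split=> //; apply/eqP => v0.
have : range T u by rewrite Tu; exists 1; rewrite ?scale1r.
by move=> [x _]; rewrite TE v0 /rank1 inner0r mulr0 scale0r => /eqP; rewrite eq_sym (negPf u0).
Qed.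

(** A finite partial sum is <P u, v> with P the projection, and P u tends to [u]. *)
Lemma is_trace_rank1 u v : is_trace (rank1 1 u v) (inner u v).
Proof.
move=> E bE eps eps0.
have v1 : 0 < rnorm v + 1 by rewrite ltr_wpDl ?rnorm_ge0.
have [|F0 F0P hF0] := @ortho_proj_cvg R H E u (eps / (rnorm v + 1)) bE.
  by rewrite divr_gt0.
exists F0 => // F finF F0F FE.
have -> : \sum_(e \in F) inner (rank1 1 u v e) e = inner (ortho_proj F u) v.
  rewrite inner_ortho_proj //; apply: eq_fsbigr => e _.
  by rewrite /rank1 mul1r innerZl mulrC.
rewrite -innerBl -normrN -innerNl opprB.
apply: le_lt_trans (norm_inner_le _ _) _; rewrite ltcR.
have := hF0 _ finF F0F FE; rewrite ltr_pdivlMr // => /(le_lt_trans _); apply.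
by rewrite ler_wpM2l ?rnorm_ge0 // lerDl.
Qed.

Lemma trace_rank1 u v : trace (rank1 1 u v) = inner u v.
Proof.
rewrite /trace; apply: xget_unique => [|t tT]; first exact: is_trace_rank1.
(* [is_trace] quantifies over all bases, so it determines its value only once a basis exists. *)
have [E bE] := ex_orthonormal_basis H.
exact: has_sum_unique (tT _ bE) (@is_trace_rank1 u v _ bE).
Qed.

Lemma opnorm_rank1 u v : v != 0 -> opnorm (rank1 1 u v) = rnorm u * rnorm v.
Proof.
move=> v0; have rv : 0 < rnorm v.
  by rewrite lt_def rnorm_ge0 andbT; apply: contra v0 => /eqP/rnorm_eq0 ->.
have ub (r : R) : [set complex.Re `|rank1 1 u v x| | x in [set x : H | `|x| <= 1]] r ->
    r <= rnorm u * rnorm v.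
  move=> [x /= x1 <-]; rewrite -lecR RRe_real ?normr_real // /rank1 mul1r normrZ.
  rewrite rmorphM /= -[(rnorm u)%:C]rnormE mulrC ler_wpM2l //.
  apply: le_trans (norm_inner_le _ _) _; rewrite lecR ler_piMl ?rnorm_ge0 //.
  by rewrite -lecR -rnormE.
have mem : [set complex.Re `|rank1 1 u v x| | x in [set x : H | `|x| <= 1]]
    (rnorm u * rnorm v).
  (* The unit vector along [v] attains the Cauchy-Schwarz bound. *)
  exists ((rnorm v)^-1%:C *: v).
    rewrite /= normrZ rnormE normc_def /= expr0n addr0 sqrtr_sqr -rmorphM /=.
    by rewrite ger0_norm ?invr_ge0 ?rnorm_ge0 // mulVf ?gt_eqF.
  rewrite /rank1 mul1r innerZl innerxx -rmorphM /= expr2 mulrA mulVf ?gt_eqF //.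
  rewrite mul1r normrZ -rnormE normr_id !rnormE -rmorphM /=.
  by rewrite mulrC.
apply/eqP; rewrite eq_le; apply/andP; split.
  by apply: ge_sup => // ; exists (rnorm u * rnorm v).
by apply: ub_le_sup => //; exists (rnorm u * rnorm v).
Qed.

Lemma collinear_inner x y e : x = e *: y ->
  inner x y * (inner x y)^*%R = inner x x * inner y y.
Proof.
move=> ->; rewrite !innerZl innerZr rmorphM /= -innerC; ring.
Qed.

(** These are squared operator norms. The left operator attains its norm along [y]; there
    Cauchy-Schwarz bounds the right one. *)
Lemma rank1_sqnorm_le c d x y u v : y != 0 -> rank1 c x y = rank1 d u v ->
  c * c^*%R * (inner x x * inner y y) <= d * d^*%R * (inner u u * inner v v).
Proof.
move=> y0 /(congr1 (fun A => inner (A y) (A y))).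
have q0 := inner_gt0 y0.
rewrite !rank1_sqnorm -innerC => e.
rewrite -(ler_pM2r q0).
have -> : c * c^*%R * (inner x x * inner y y) * inner y y =
  c * c^*%R * inner x x * (inner y y * inner y y) by ring.
have -> : d * d^*%R * (inner u u * inner v v) * inner y y =
  d * d^*%R * inner u u * (inner y y * inner v v) by ring.
rewrite e ler_wpM2l ?Cauchy_Schwarz //.
by rewrite -normCK mulr_ge0 ?exprn_ge0 ?inner_ge0.
Qed.

Lemma rank1_sqnorm_eq c d x y u v : y != 0 -> v != 0 ->
  rank1 c x y = rank1 d u v ->
  c * c^*%R * (inner x x * inner y y) = d * d^*%R * (inner u u * inner v v).
Proof.
move=> y0 v0 e; apply/eqP; rewrite eq_le.
by rewrite (rank1_sqnorm_le y0 e) (rank1_sqnorm_le v0 (esym e)).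
Qed.

Lemma rank1_range_collinear c d x y u v : c != 0 -> y != 0 ->
  rank1 c x y = rank1 d u v -> exists e, x = e *: u.
Proof.
move=> c0 y0 /(congr1 (@^~ y)); rewrite /rank1 => e.
have cy : c * inner y y != 0 by rewrite mulf_neq0 // gt_eqF // inner_gt0.
exists ((c * inner y y)^-1 * (d * inner y v)).
by rewrite -scalerA -e scalerA mulVf // scale1r.
Qed.
End RankOne.

(** * Words in [T] and its adjoint, and the ideals they form *)

Section Words.
Variables (R : realType) (H : hilbert R) (u v : H).
Hypotheses (u0 : u != 0) (v0 : v != 0).
Implicit Types (A B X : H -> H) (J : set (H -> H)).

Let a := inner u v.
Let p := inner u u.
Let q := inner v v.
Let s := p * q.
Let T := rank1 1 u v.
Let T' := rank1 1 v u.
Let S := generated_semigroup [set T; T'].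

Let vu : inner v u = a^*%R. Proof. by rewrite innerC. Qed.
Let p_gt0 : 0 < p. Proof. exact: inner_gt0. Qed.
Let q_gt0 : 0 < q. Proof. exact: inner_gt0. Qed.
Let s_gt0 : 0 < s. Proof. by rewrite mulr_gt0. Qed.
Let pJ : p^*%R = p. Proof. by rewrite /p -innerC. Qed.
Let qJ : q^*%R = q. Proof. by rewrite /q -innerC. Qed.
Let sJ : s^*%R = s. Proof. by rewrite rmorphM /= pJ qJ. Qed.

Let ST : S T. Proof. by apply: generated_letter; left. Qed.
Let ST' : S T'. Proof. by apply: generated_letter; right. Qed.

Definition word_coef i j k : R[i] := a ^+ i * a^*%R ^+ j * s ^+ k.
Local Notation m := word_coef.

Lemma word_coefM i j k i' j' k' :
  m i j k * m i' j' k' = m (i + i') (j + j') (k + k').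
Proof. rewrite /m !exprD; ring. Qed.

Lemma word_coefX i j k n : m i j k ^+ n = m (i * n) (j * n) (k * n).
Proof. by rewrite /m !exprMn -!exprM. Qed.

Lemma conj_word_coef i j k : (m i j k)^*%R = m j i k.
Proof. by rewrite /m rmorphM rmorphM /= !rmorphXn /= conjCK sJ [X in X * _]mulrC. Qed.

Lemma word_coef_sqr i j k :
  m i j k * (m i j k)^*%R = (a * a^*%R) ^+ (i + j) * s ^+ k.*2.
Proof. by rewrite conj_word_coef word_coefM /m addnn (addnC j i) (exprMn _ a). Qed.

(* The relations between [T] and [T'] reduce every word to a multiple of [T],
   [T'], [T \o T'] or [T' \o T]. With [b = true] the exponent of [s] in the
   shape [T'] must be positive, which rules out the powers of [T']: the words
   that contain the letter [T] then form an ideal. *)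
Inductive word_form (b : bool) (w : R[i]) : set (H -> H) :=
| word_form_T i j k : word_form b w (rank1 (w * m i j k) u v)
| word_form_T' i j k : (b <= k)%N -> word_form b w (rank1 (w * m i j k) v u)
| word_form_TT' i j k : word_form b w (rank1 (w * m i j k * q) u u)
| word_form_T'T i j k : word_form b w (rank1 (w * m i j k * p) v v).

Lemma word_form_closed b w A : word_form b w A ->
  [/\ word_form b w (T \o A), word_form b w (T' \o A),
      word_form b w (A \o T) & word_form b w (A \o T')].
Proof.
have formT i j k c : c = w * m i j k -> word_form b w (rank1 c u v).
  by move=> ->; exact: word_form_T.
have formT' i j k c : (b <= k)%N -> c = w * m i j k -> word_form b w (rank1 c v u).
  by move=> bk ->; exact: word_form_T'.
have formTT' i j k c : c = w * m i j k * q -> word_form b w (rank1 c u u).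
  by move=> ->; exact: word_form_TT'.
have formT'T i j k c : c = w * m i j k * p -> word_form b w (rank1 c v v).
  by move=> ->; exact: word_form_T'T.
have mS1 i j k : m i.+1 j k = m i j k * a by rewrite /m exprS; ring.
have mS2 i j k : m i j.+1 k = m i j k * a^*%R by rewrite /m exprS; ring.
have mS3 i j k : m i j k.+1 = m i j k * s by rewrite /m exprS; ring.
case=> [i j k|i j k bk|i j k|i j k]; split; rewrite rank1_comp ?vu -?/a -?/p -?/q.
- apply: (formT i.+1 j k); rewrite mS1; ring.
- apply: (formT'T i j k); ring.
- apply: (formT i.+1 j k); rewrite mS1; ring.
- apply: (formTT' i j k); ring.
- apply: (formTT' i j k); ring.
- apply: (formT' i j.+1 k) => //; rewrite mS2; ring.
- apply: (formT'T i j k); ring.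
- apply: (formT' i j.+1 k) => //; rewrite mS2; ring.
- apply: (formTT' i.+1 j k); rewrite mS1; ring.
(* The shape [T'] reached from another shape gains a factor [s], so its exponent is positive for
   either value of [b]. *)
- apply: (formT' i j k.+1); [exact: leq_trans (leq_b1 b) _|rewrite mS3 /s; ring].
- apply: (formT i j k.+1); rewrite mS3 /s; ring.
- apply: (formTT' i j.+1 k); rewrite mS2; ring.
- apply: (formT i j k.+1); rewrite mS3 /s; ring.
- apply: (formT'T i j.+1 k); rewrite mS2; ring.
- apply: (formT'T i.+1 j k); rewrite mS1; ring.
- apply: (formT' i j k.+1); [exact: leq_trans (leq_b1 b) _|rewrite mS3 /s; ring].
Qed.

Lemma letters_ideal J : J `<=` S ->
  (forall A, J A -> [/\ J (T \o A), J (T' \o A), J (A \o T) & J (A \o T')]) ->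
  semigroup_ideal S J.
Proof.
move=> JS Jcl; split=> // A X JA SX; elim: SX A JA => {X}.
  by move=> X [->|->] A /Jcl[].
move=> L B LG _ IH A JA; split.
  by have [JBA _] := IH _ JA; have [] := Jcl _ JBA; case: LG => ->.
have [_ _ JAT JAT'] := Jcl _ JA.
by case: LG => ->; [exact: (IH _ JAT).2 | exact: (IH _ JAT').2].
Qed.

Lemma semigroup_comp A B : S A -> S B -> S (A \o B).
Proof.
move=> SA SB; elim: SA => {A} [A GA|A C GA _ IH]; first exact: generated_word.
exact: (generated_word GA IH).
Qed.

Lemma semigroup_word_form A : S A -> word_form false 1 A.
Proof.
have letter B : [set T; T'] B -> word_form false 1 B.
  have m0 : 1 * m 0 0 0 = 1 by rewrite /m !expr0 !mulr1.
  case=> ->; first by have := word_form_T false 1 0 0 0; rewrite m0.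
  by have := @word_form_T' false 1 0 0 0; rewrite m0; apply.
elim=> {A} [A /letter //|A B GA _ /word_form_closed[]].
by case: GA => ->.
Qed.

(** With [b = true], the case [w = 1] gives an ideal containing [T], and [w = a] one containing
    [T \o T]. *)
Lemma word_form_ideal b w : semigroup_ideal S (S `&` word_form b w).
Proof.
apply: letters_ideal => [A []//|A [SA /word_form_closed[? ? ? ?]]].
by do !split=> //; apply: semigroup_comp.
Qed.

(** Multiplying by [T] on suitable sides turns every other shape into a multiple of [T], at the cost
    of a factor [s], which is nonzero. *)
Lemma ideal_nonzero_T J : semigroup_ideal S J -> nonzero_set J ->
  exists i j k, m i j k != 0 /\ J (rank1 (m i j k) u v).
Proof.
move=> [JS Jid] [A JA A0].
have rank1_0 x y : rank1 0 x y = (fun=> 0) :> (H -> H).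
  by apply/funext => z; rewrite /rank1 mul0r scale0r.
have mS3 i j k : m i j k.+1 = m i j k * s by rewrite /m exprS; ring.
have sN0 : s != 0 by rewrite gt_eqF.
have Aform := semigroup_word_form (JS _ JA).
case: Aform JA A0 => [i j k|i j k _|i j k|i j k];
  rewrite mul1r => JA A0;
  have mN0 : m i j k != 0 by apply: contra_not_neq A0 => ->; rewrite ?mul0r rank1_0.
- by exists i, j, k.
- exists i, j, k.+1; rewrite mS3 mulf_neq0 //; split=> //.
  have := (Jid _ _ (Jid _ _ JA ST).1 ST).2.
  by rewrite !rank1_comp -/p -/q mul1r mulr1 /s (mulrC p) mulrA.
- exists i, j, k.+1; rewrite mS3 mulf_neq0 //; split=> //.
  have := (Jid _ _ JA ST).2.
  by rewrite !rank1_comp -/p -/q mulr1 /s (mulrC p) mulrA.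
- exists i, j, k.+1; rewrite mS3 mulf_neq0 //; split=> //.
  have := (Jid _ _ JA ST).1.
  by rewrite !rank1_comp -/p -/q mul1r /s mulrA.
Qed.

(** Right multiplication by [T] yields [a], and by [T'] then [T] yields [s]. The conjugate of [a] is
    gained in the shape [T \o T']; this detour costs one factor [s], hence [k.+1]. *)
Lemma ideal_pump J c i j k : semigroup_ideal S J -> J (rank1 c u v) ->
  J (rank1 (c * m i j k.+1) u v).
Proof.
move=> [_ Jid] Jc.
have Ji n d : J (rank1 d u v) -> J (rank1 (d * a ^+ n) u v).
  elim: n d => [|n IH] d Jd; first by rewrite mulr1.
  by rewrite exprS mulrA; apply: IH; have := (Jid _ _ Jd ST).2; rewrite rank1_comp mulr1.
have Jj n d : J (rank1 d u u) -> J (rank1 (d * a^*%R ^+ n) u u).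
  elim: n d => [|n IH] d Jd; first by rewrite mulr1.
  by rewrite exprS mulrA; apply: IH; have := (Jid _ _ Jd ST').2; rewrite rank1_comp mulr1 vu.
have Jk n d : J (rank1 d u v) -> J (rank1 (d * s ^+ n) u v).
  elim: n d => [|n IH] d Jd; first by rewrite mulr1.
  rewrite exprS mulrA; apply: IH; have := (Jid _ _ (Jid _ _ Jd ST').2 ST).2.
  by rewrite !rank1_comp !mulr1 -/p -/q /s (mulrC p) mulrA.
have := (Jid _ _ (Jk k _ (Ji i _ Jc)) ST').2; rewrite rank1_comp => /(Jj j) Juu.
have := (Jid _ _ Juu ST).2; rewrite rank1_comp !mulr1 -/p -/q; congr (J (rank1 _ _ _)).
by rewrite /m exprS /s; ring.
Qed.

(** The relation makes [a], its conjugate and [s] invertible in the monoid of coefficients, so the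
    coefficient of a multiple of [T] in [J] can be pumped up to 1. *)
Lemma ideal_contains_T n k J : m n n k.+1 = 1 -> (0 < n)%N ->
  semigroup_ideal S J -> nonzero_set J -> J T.
Proof.
move=> mnk n0 Jid Jn0; have [i [j [l [_ Jm]]]] := ideal_nonzero_T Jid Jn0.
(* The target is the [N]-th power of the relation; this [N] exceeds [i], [j] and [l], so every
   exponent still to be added is nonnegative, and that of [s] positive. *)
pose N := (i + j + l).+1.
have := ideal_pump (n * N - i) (n * N - j) (k.+1 * N - l).-1 Jid Jm.
rewrite word_coefM prednK; last by rewrite subn_gt0; nia.
rewrite !subnKC -?word_coefX ?mnk ?expr1n //; nia.
Qed.

(** * Consequences of the SI property *)

Lemma adjointT : adjoint T = T'.
Proof. by rewrite adjoint_rank1 rmorph1. Qed.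

Lemma SI_ideal_full J : SI_semigroup S -> semigroup_ideal S J -> J T -> J = S.
Proof.
move=> SI Jid JT; have JT' : J T' by apply: (SI _ Jid); exists T => //; exact: adjointT.
apply/seteqP; split=> [|A]; first exact: Jid.1.
by case=> {}A; [case=> -> | move=> B [->|->] SB; apply: (Jid.2 _ _ _ SB).2].
Qed.

Lemma SI_simple : SI_semigroup S ->
  (forall J, semigroup_ideal S J -> nonzero_set J -> J T) -> simple_semigroup S.
Proof. by move=> SI h J Jid Jn0; apply: SI_ideal_full => //; exact: h. Qed.

Let aa_ge0 : 0 <= a * a^*%R. Proof. by rewrite -normCK exprn_ge0. Qed.

Lemma SI_word_form w A : SI_semigroup S -> S A -> word_form true w A ->
  word_form true w (adjoint A).
Proof.
move=> SI SA fA; suff [] : (S `&` word_form true w) (adjoint A) by [].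
by apply: (SI _ (word_form_ideal true w)); exists A.
Qed.

Lemma SI_word_form_T' : SI_semigroup S -> word_form true 1 T'.
Proof.
move=> SI; rewrite -adjointT; apply: SI_word_form => //.
by have := word_form_T true 1 0 0 0; rewrite /m !expr0 !mulr1.
Qed.

Lemma SI_dependent_simple : SI_semigroup S -> T' <> T -> a * a^*%R = s ->
  simple_semigroup S.
Proof.
(* Since [s] is positive, a relation [s ^+ n = 1] gives [s = 1], hence |a| = 1, and pumping
   applies. *)
move=> SI T'T aas.
have s_eq1 n : (0 < n)%N -> s ^+ n = 1 -> simple_semigroup S.
  move=> n0 /eqP; rewrite pexpr_eq1 ?ltW // => /eqP s1.
  apply: SI_simple => // J; apply: (@ideal_contains_T 1 0) => //.
  by rewrite /m !expr1 aas s1 mulr1.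
have msqr i j k : m i j k * (m i j k)^*%R = s ^+ (i + j + k.*2).
  by rewrite word_coef_sqr aas -exprD.
have sN0 : s != 0 by rewrite gt_eqF.
have norm c x y : y != 0 -> T' = rank1 c x y ->
    s = c * c^*%R * (inner x x * inner y y).
  move=> y0 /(rank1_sqnorm_eq u0 y0).
  by rewrite rmorph1 !mul1r => <-; rewrite mulrC.
move: (SI_word_form_T' SI); move T'E: T' => B fB.
case: fB T'E => [i j k|i j k k0|i j k|i j k]; rewrite mul1r => T'E.
- have := norm _ _ _ v0 T'E; rewrite -/p -/q -/s msqr.
  have [n0|n0 /esym e] := posnP (i + j + k.*2).
    (* Zero exponents would make [T] selfadjoint. *)
    case: T'T; rewrite T'E; have [-> [-> ->]] : i = 0%N /\ j = 0%N /\ k = 0%N by lia.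
    by rewrite /m !expr0 !mulr1.
  by apply: (s_eq1 _ n0); apply: (mulIf sN0); rewrite e mul1r.
(* Here the exponent of [s] is positive because [k] is, by the choice [b = true]. *)
- have := norm _ _ _ u0 T'E; rewrite -/p -/q (mulrC q) -/s msqr => /esym e.
  apply: (s_eq1 (i + j + k.*2)%N); first lia.
  by apply: (mulIf sN0); rewrite e mul1r.
- have := norm _ _ _ u0 T'E; rewrite rmorphM /= qJ -/p => e.
  apply: (s_eq1 (i + j + k.*2).+1) => //; apply: (mulIf sN0).
  by rewrite mul1r exprSr -msqr [RHS]e /s; ring.
- have := norm _ _ _ v0 T'E; rewrite rmorphM /= pJ -/q => e.
  apply: (s_eq1 (i + j + k.*2).+1) => //; apply: (mulIf sN0).
  by rewrite mul1r exprSr -msqr [RHS]e /s; ring.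
Qed.

Lemma collinear_vu e : v = e *: u -> a * a^*%R = s.
Proof. by move/collinear_inner; rewrite vu conjCK mulrC /s mulrC [RHS]mulrC. Qed.

Lemma rank1_T'_form w (c : R[i]) : c != 0 -> a * a^*%R <> s ->
  word_form true w (rank1 c v u) ->
  exists i j k, (0 < k)%N /\ c = w * m i j k.
Proof.
move=> c0 ind; move E: (rank1 c v u) => B fB.
case: fB E => [i j k|i j k k0|i j k|i j k] E.
- by have [e /collinear_vu] := rank1_range_collinear c0 u0 E.
- by exists i, j, k; split=> //; exact: rank1_inj v0 u0 E.
- by have [e /collinear_vu] := rank1_range_collinear c0 u0 E.
(* Both ranges are spanned by [v]; those of the adjoints, by [u] and [v], tell the shapes apart. *)
- have := congr1 (@adjoint R H) E; rewrite !adjoint_rank1 => E'.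
  have c0' : c^*%R != 0 by rewrite fmorph_eq0.
  by have [e /collinear_inner] := rank1_range_collinear c0' v0 E'.
Qed.

Lemma SI_independent : SI_semigroup S -> ~ simple_semigroup S ->
  a * a^*%R <> s -> [/\ s = 1, a != 0 & a^*%R = a].
Proof.
move=> SI nsimple ind.
have [i [j [k [k0]]]] := rank1_T'_form (oner_neq0 _) ind (SI_word_form_T' SI).
rewrite mul1r => /esym m1.
have s1 : s = 1.
  (* If [a] or its conjugate occurs, the relation times its conjugate has equal exponents, as
     pumping requires. *)
  have [ij0|ij0] := posnP (i + j)%N; last first.
    case: nsimple; apply: SI_simple => // J.
    apply: (@ideal_contains_T (i + j) k.*2.-1) => //.
    have := word_coef_sqr i j k; rewrite m1 rmorph1 mulr1 exprMn => ->.
    by rewrite /m prednK // double_gt0.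
  move: m1; have [-> ->] : i = 0%N /\ j = 0%N by lia.
  rewrite /m !expr0 !mul1r => /eqP; rewrite pexpr_eq1 ?ltW // => /eqP //.
have aN0 : a != 0.
  (* With [a = 0] and [s = 1] the only nonzero coefficient is 1, so every nonzero ideal contains
     [T]. *)
  apply: contra_not_neq nsimple => a0; apply: SI_simple => // J Jid Jn0.
  have [i' [j' [k' []]]] := ideal_nonzero_T Jid Jn0.
  rewrite /m s1 expr1n mulr1 a0 rmorph0 !expr0n.
  by case: i' => [|i']; case: j' => [|j']; rewrite ?mulr0 ?mul0r ?eqxx //= mulr1.
split=> //.
have STT : S (rank1 a u v).
  by have := semigroup_comp ST ST; rewrite rank1_comp mulr1 mul1r.
have fTT : word_form true a (rank1 a u v).
  by have := word_form_T true a 0 0 0; rewrite /m !expr0 !mulr1.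
have := SI_word_form SI STT fTT; rewrite adjoint_rank1 => fT'T'.
have aJN0 : a^*%R != 0 by rewrite fmorph_eq0.
have [i' [j' [k' [_ aE]]]] := rank1_T'_form aJN0 ind fT'T'.
have aaN0 : a * a^*%R != 0 by rewrite mulf_neq0.
(* Taking squared moduli in [aE], where [s = 1]. A positive exponent would give |a| = 1, excluded by
   [ind]; so the coefficient is trivial and [a] is real. *)
have : (a * a^*%R) ^+ (i' + j') = 1.
  have := congr1 (fun z => z * z^*%R) aE; rewrite rmorphM /= conjCK => e.
  apply: (mulfI aaN0); rewrite mulr1 [RHS]mulrC e mulrACA word_coef_sqr s1.
  by rewrite expr1n mulr1.
have [ij0 _|ij0 /eqP] := posnP (i' + j')%N; last first.
  by rewrite pexpr_eq1 // => /eqP aa1; case: ind; rewrite aa1 s1.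
rewrite aE; have [-> ->] : i' = 0%N /\ j' = 0%N by lia.
by rewrite /m s1 expr1n !expr0 !mulr1.
Qed.

(** The two products have ranges spanned by [u] and by [v]; normality thus means dependence, the
    equality case of Cauchy-Schwarz. *)
Lemma normal_iff : T \o T' = T' \o T <-> a * a^*%R = s.
Proof.
rewrite !rank1_comp -/p -/q !mul1r; split=> [E|aas].
  have [e /collinear_inner//] : exists e, u = e *: v.
  by apply: rank1_range_collinear E; rewrite ?gt_eqF.
have qu := Cauchy_Schwarz_eq aas; rewrite -/a -/q in qu.
apply/funext => z; rewrite /rank1.
have zu : q * inner z u = a^*%R * inner z v.
  by rewrite -innerZr -qu innerZr qJ.
have qN0 : q != 0 by rewrite gt_eqF.
apply: (scalerI qN0); rewrite zu.
transitivity ((a^*%R * inner z v) *: (q *: u)); first by rewrite !scalerA mulrC.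
rewrite qu !scalerA.
congr (_ *: _); transitivity (a * a^*%R * inner z v); first by ring.
by rewrite aas /s; ring.
Qed.

(** * Sufficiency: the SI property and a proper nonzero ideal *)

Lemma SI_sufficient : s = 1 -> a^*%R = a -> SI_semigroup S.
Proof.
move=> s1 aJ J Jid _ [A JA <-]; have fA := semigroup_word_form (Jid.1 _ JA).
have mJ i j k : (m i j k)^*%R = m i j k by rewrite conj_word_coef /m aJ (mulrC (a ^+ j)).
case: fA JA => [i j k|i j k _|i j k|i j k] JA; rewrite adjoint_rank1 mul1r in JA *.
- have := (Jid.2 _ _ (Jid.2 _ _ JA ST').1 ST').2.
  by rewrite !rank1_comp -/p -/q mul1r mulr1 -mulrA -/s s1 mulr1 mJ.
- have := (Jid.2 _ _ (Jid.2 _ _ JA ST).1 ST).2.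
  by rewrite !rank1_comp -/p -/q mul1r mulr1 -mulrA (mulrC q) -/s s1 mulr1 mJ.
(* With real coefficients, the shapes [T \o T'] and [T' \o T] are selfadjoint. *)
- by rewrite rmorphM /= mJ qJ.
- by rewrite rmorphM /= mJ pJ.
Qed.

Lemma not_simple : s = 1 -> a != 0 -> a * a^*%R <> s -> ~ simple_semigroup S.
Proof.
move=> s1 a0 ind simple.
have aa_lt1 : a * a^*%R < 1.
  rewrite -s1 lt_neqAle Cauchy_Schwarz andbT; exact/eqP.
(* As [s = 1], every word is a contraction, so multiplication by words preserves the norm bound that
   defines [J]. *)
have contr A x : S A -> inner (A x) (A x) <= inner x x.
  have letter B y : [set T; T'] B -> inner (B y) (B y) <= inner y y.
    case=> ->; rewrite rank1_sqnorm rmorph1 !mul1r.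
      have -> : inner y y = p * (inner y y * q) by rewrite mulrCA -/s s1 mulr1.
      by rewrite ler_wpM2l ?Cauchy_Schwarz // ltW.
    have -> : inner y y = q * (inner y y * p).
      by rewrite mulrCA (mulrC q) -/s s1 mulr1.
    by rewrite ler_wpM2l ?Cauchy_Schwarz // ltW.
  move=> SA; elim: SA x => {A} [A GA x|A B GA _ IH x]; first exact: letter.
  by apply: le_trans (letter _ _ GA) (IH _).
pose J := S `&` [set A | forall x, inner (A x) (A x) <= a * a^*%R * inner x x].
have Jid : semigroup_ideal S J.
  split=> [A []//|A X [SA hA] SX]; split; split; try exact: semigroup_comp.
  - by move=> x; apply: le_trans (contr _ _ SX) (hA x).
  - by move=> x; apply: le_trans (hA _) _; rewrite ler_wpM2l // contr.
have JTT : J (rank1 a u v).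
  split; first by have := semigroup_comp ST ST; rewrite rank1_comp mulr1 mul1r.
  move=> x /=; rewrite rank1_sqnorm -[a * _ * _ * _]mulrA ler_wpM2l //.
  by have := contr T x ST; rewrite rank1_sqnorm rmorph1 !mul1r.
have JS : J = S.
  apply: simple => //; exists (rank1 a u v) => //.
  move=> /(congr1 (@^~ v))/eqP; rewrite /rank1 scaler_eq0 mulf_eq0.
  by rewrite (negPf a0) (negPf u0) orbF gt_eqF.
have : J T by rewrite JS.
(* At [v] the operator [T] attains its norm 1, which exceeds |a|. *)
move=> [_ /(_ v)]; rewrite rank1_sqnorm rmorph1 !mul1r -/q qJ mulrA -/s s1 mul1r.
by rewrite -subr_le0 -{1}[q]mul1r -mulrBl pmulr_lle0 // subr_le0 
  => /le_lt_trans/(_ aa_lt1); rewrite ltxx.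
Qed.
End Words.

Lemma opnorm_rank1_eq1 (R : realType) (H : hilbert R) (u v : H) : v != 0 ->
  opnorm (rank1 1 u v) = 1 <-> inner u u * inner v v = 1.
Proof.
move=> v0; rewrite opnorm_rank1 // !innerxx -rmorphM -exprMn /=.
split=> [->|/(congr1 (@complex.Re R))/= /eqP]; first by rewrite expr1n.
by rewrite pexpr_eq1 ?mulr_ge0 ?rnorm_ge0 // => /eqP.
Qed.

Theorem theorem3p19 (R : realType) (H : hilbert R) (T : H -> H)
    (T_bounded : bounded_operator T) (T_rank_one : rank_one T)
    (T_nonselfadjoint : ~ selfadjoint T) :
  (SI_semigroup (semigroup_with_adjoint T) /\
   ~ simple_semigroup (semigroup_with_adjoint T))
  <->
  [/\ ~ normal_operator T,
      trace T \is Num.real,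
      trace T <> 0 /\ trace T <> 1 /\ trace T <> -1 &
      opnorm T = 1].
Proof.
have [u [v [u0 v0 TE]]] := rank_one_rank1 T_bounded T_rank_one.
move: T_nonselfadjoint; rewrite /selfadjoint /semigroup_with_adjoint /normal_operator.
rewrite TE adjointT // trace_rank1 => nsa.
have opn := opnorm_rank1_eq1 u v0; have nrm := normal_iff u0 v0.
split=> [[SI nsimple]|[nn areal [a0 _] /opn s1]].
  have ind : inner u v * (inner u v)^*%R <> inner u u * inner v v.
    by move=> aas; apply: nsimple; exact: SI_dependent_simple.
  have [s1 a0 aJ] := SI_independent u0 v0 SI nsimple ind.
  rewrite aJ s1 in ind; split; [by move/nrm; rewrite aJ s1| exact/CrealP| |exact/opn].
  split; first exact/eqP.
  (* Trace 1 or -1 would give |a|^2 = 1 = s, the normal case. *)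
  by split=> a1; apply: ind; rewrite a1 ?mulr1 ?mulrNN ?mulr1.
have ind : inner u v * (inner u v)^*%R <> inner u u * inner v v by move/nrm.
split; first by apply: SI_sufficient => //; exact/CrealP.
by apply: not_simple => //; exact/eqP.
Qed.
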